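(* Let $W=(w_j)_{j\in\mathbb Z}$ be a balanced non-periodic word over an alphabet $\{a_1,\dots,a_n\}$, and let $M\subset\mathbb T^n$ be the closure of the trajectory of the point $x=(x_1,\dots,x_n)$ under the translation $T_\gamma$, $\gamma=(\alpha_1,\dots,\alpha_n)$, associated with $W$ as described in the context. Then $M$ is homeomorphic to $\mathbb S^1\times\{1,2,\dots,N\}$ for some positive integer $N$.
   Context: A (two-sided) infinite word $W$ over $\{a_1,\dots,a_n\}$ is balanced if for any two finite subwords $u,v$ of $W$ of equal length and every letter $a_i$ one has $\bigl||u|_{a_i}-|v|_{a_i}\bigr|\le 1$, where $|u|_{a_i}$ is the number of occurrences of $a_i$ in $u$. For each $i$ define the word $W_i=(w^i_j)_{j\in\mathbb Z}$ over the binary alphabet $\{a_i,\bar a_i\}$ by $w^i_j=a_i$ if $w_j=a_i$ and $w^i_j=\bar a_i$ if $w_j\ne a_i$. Each $W_i$ is generated by a dynamics $(\mathbb S^1,T_{\alpha_i},\Delta_i,x_i)$, where $\mathbb S^1=\mathbb R/\mathbb Z$, $T_{\alpha_i}$ is the rotation by an irrational $\alpha_i$, $\Delta_i\subset\mathbb S^1$ is an arc of length $\alpha_i$, and $x_i\in\mathbb S^1$ is the initial point; ''generated'' means that $w^i_j=a_i$ exactly when $T_{\alpha_i}^{j}(x_i)\in\Delta_i$. Fix such dynamics for $i=1,\dots,n$. $\mathbb T^n=(\mathbb S^1)^n$ is the $n$-dimensional torus and $T_\gamma:\mathbb T^n\to\mathbb T^n$ is the translation by the vector $\gamma=(\alpha_1,\dots,\alpha_n)$.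 *)

(* Defs.v *)
From HB Require Import structures.
From mathcomp Require Import all_boot all_order all_algebra.
From mathcomp Require Import all_classical all_reals all_analysis.

Set Implicit Arguments.
Unset Strict Implicit.
Unset Printing Implicit Defensive.

Import Order.TTheory GRing.Theory Num.Theory.
Import numFieldNormedType.Exports.

Local Open Scope classical_set_scope.
Local Open Scope ring_scope.
Local Open Scope quotient_scope.

Section Words.
Context {A : eqType}.
Implicit Types (W : int -> A) (u v : seq A) (a : A).

Definition subword u W : Prop :=
  exists p : int, u = mkseq (fun k => W (p + k%:Z)) (size u).

Definition balanced_word W : Prop :=
  forall u v, subword u W -> subword v W -> size u = size v ->
  forall a, `|(count_mem a u)%:Z - (count_mem a v)%:Z| <= 1.

Definition periodic_word W : Prop :=
  exists p : nat, (0 < p)%N /\ forall j : int, W (j + p%:Z) = W j.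

(* The binary alphabet {a, \bar a} is [bool], [true] standing for a. *)
Definition letter_word W a : int -> bool := fun j => W j == a.

End Words.

(* [Num.int_num_subdef] is the predicate underlying [Num.int], on which the
   closure instances are declared. *)
Definition integers (R : realType) : zmodClosed R :=
  GRing.ZmodClosed.clone R Num.int_num_subdef _.

(* R/Z as a quotient group, with the quotient topology. *)
Definition circle (R : realType) : Type :=
  quotient_topology (Quotient.quot (integers R)).

HB.instance Definition _ (R : realType) := Topological.on (circle R).
HB.instance Definition _ (R : realType) := Quotient.on (circle R).
HB.instance Definition _ (R : realType) :=
  GRing.isZmodule.Build (circle R)
    (@Quotient.addqA R (integers R)) (@Quotient.addqC R (integers R))
    (@Quotient.add0q R (integers R)) (@Quotient.addNq R (integers R)).

Definition to_circle (R : realType) : R -> circle R := \pi_(circle R).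

Lemma to_circle_eq (R : realType) (s t : R) :
  to_circle s = to_circle t <-> s - t \is a Num.int.
Proof.
have E := Quotient.idealrBE (integers R) s t.
split=> h; first by apply: etrans E _; apply/eqP; exact: h.
by have /eqP := etrans (esym E) h.
Qed.

Lemma to_circleD (R : realType) (s t : R) :
  to_circle (s + t) = to_circle s + to_circle t.
Proof. exact: (Quotient.pi_add (integers R)). Qed.

(* [prod_topology] is a dependent function type with the product topology. *)
Definition torus (R : realType) (n : nat) : Type :=
  prod_topology (fun _ : 'I_n => circle R).

HB.instance Definition _ (R : realType) (n : nat) := Topological.on (torus R n).
HB.instance Definition _ (R : realType) (n : nat) :=
  GRing.Zmodule.copy (torus R n) ('I_n -> circle R).

Section Translations.
Context {G : zmodType}.

Definition translation (g x : G) : G := x + g.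

(* T_g ^ j for j in Z: [Negz k] is - k.+1, and T_(- g) is the inverse of T_g. *)
Definition translation_pow (g : G) (j : int) (x : G) : G :=
  match j with
  | Posz k => iter k (translation g) x
  | Negz k => iter k.+1 (translation (- g)) x
  end.

Lemma translation_powE (g : G) (j : int) (x : G) :
  translation_pow g j x = x + g *~ j.
Proof.
have H h k : iter k (translation h) x = x + h *+ k.
  by elim: k => [|k IH]; rewrite ?addr0//= IH mulrSr addrA.
by case: j => k; rewrite /translation_pow H // mulNrn.
Qed.

Definition trajectory (g x : G) : set G :=
  range (fun j : int => translation_pow g j x).

End Translations.

(* [bl] and [br] range over the open, half-open and closed arcs. *)
Definition is_arc (R : realType) (D : set (circle R)) (l : R) : Prop :=
  0 < l < 1 /\
  exists (c : R) (bl br : bool),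
    D = @to_circle R @` [set` Interval (BSide bl c) (BSide br (c + l))].

Definition generated_by (R : realType) (V : int -> bool)
    (alpha : R) (D : set (circle R)) (x : circle R) : Prop :=
  [/\ irrational alpha, is_arc D alpha &
      forall j : int, V j <-> D (translation_pow (to_circle alpha) j x)].

Definition homeomorphic (T U : topologicalType) : Prop :=
  exists (f : T -> U) (g : U -> T),
    [/\ continuous f, continuous g, cancel f g & cancel g f].

(* Main.v *)
Require Import Defs.
From HB Require Import structures.
From mathcomp Require Import all_boot all_order all_algebra.
From mathcomp Require Import all_classical all_reals all_analysis.
From mathcomp Require Import ring lra zify.

Set Implicit Arguments.
Unset Strict Implicit.
Unset Printing Implicit Defensive.

Import Order.TTheory GRing.Theory Num.Theory.
Import numFieldNormedType.Exports.

Local Open Scope classical_set_scope.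
Local Open Scope ring_scope.

(** The orbit closure of a point under a translation of a compact abelian
    group is a coset of a closed subgroup; on the torus such a subgroup is a
    torus times a finite group, and the point is that here the torus has
    dimension one.

    Two different letters never occupy the same position.  If [1], [alpha i],
    [alpha j] were linearly independent over the rationals, Kronecker's theorem
    in dimension two ([kronecker2]) would give a time at which the rotations by
    [alpha i] and [alpha j] are simultaneously inside the two arcs.  So any two
    frequencies are related by an integer affine relation
    ([letters_dependent]).

    Clearing denominators and applying Bezout's identity to the coefficients
    ([rational_direction]), one gets an irrational [theta] and integers [p i],
    [u i] with [\sum_i u i * p i = 1] such that
    [alpha i = p i * theta + e i] with [e i] rational.  On the torus this reads
    [gamma = iota theta + e], where [iota : t |-> (t *~ p i)_i] embeds the
    circle, [L : y |-> \sum_i y i *~ u i] is a continuous homomorphism with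
    [L (iota t) = t], and [e] is a torsion element with [L e = 0].

    The map [y |-> y - iota (L y)] therefore kills the circle and fixes the
    multiples of [e].  If [N] is the order of [e], the points [y] for which
    [y - x] is sent to a multiple of [e] form a closed set, in which the
    trajectory of [x] is dense because [N * theta] is irrational
    ([orbit_closureE]).  The coordinates [L (y - x)] and the index of the
    multiple of [e] identify this set with [N] copies of the circle
    ([orbit_closure_homeomorphic]). *)

(** * Diophantine approximation *)

Lemma irrational_neq_int_frac (R : realType) (t : R) (a b : int) :
  irrational t -> a != 0 -> a%:~R * t + b%:~R != 0.
Proof.
move=> irr a0; apply/eqP => h; apply: irr; exists (- b%:~R / a%:~R) => //.
rewrite fmorph_div/= rmorphN !ratr_int.
have a0' : a%:~R != 0 :> R by rewrite intr_eq0.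
by apply: (mulfI a0'); rewrite mulrC divfK//; lra.
Qed.

(** Pigeonhole: cut the unit square into [K * K] boxes of side [1 / K < e] and
    look at the fractional parts of the multiples [j * (al, be)] with
    [j <= K * K]; two of them fall into one box, and [q] is the difference of
    their multipliers. *)
Lemma dirichlet2 (R : realType) (al be e : R) : 0 < e ->
  exists (q : nat) (a b : int),
    [/\ (0 < q)%N, `|q%:R * al - a%:~R| < e & `|q%:R * be - b%:~R| < e].
Proof.
move=> e0.
pose K := (Num.trunc e^-1).+1.
have K0 : 0 < K%:R :> R by rewrite ltr0n.
have Ke : K%:R^-1 < e.
  rewrite invf_plt ?posrE//.
  by rewrite /K; apply: truncnS_gt.
pose fr (t : R) := t - (Num.floor t)%:~R.
have fr0 t : 0 <= fr t by have /andP[] := floor_itv t; rewrite /fr subr_ge0.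
have fr1 t : fr t < 1 by have /andP[_] := floor_itv t; rewrite /fr rmorphD ltrBlDl.
pose bx (t : R) : 'I_K := inord (Num.trunc (K%:R * fr t)).
have bxE t : bx t = Num.trunc (K%:R * fr t) :> nat.
  rewrite /bx inordK// -(ltr_nat R).
  apply: le_lt_trans (_ : K%:R * fr t < _).
    have hb : 0 <= K%:R * fr t by rewrite mulr_ge0// ltW.
    by have /andP[] := truncn_itv hb.
  by rewrite -[ltRHS]mulr1 ltr_pM2l.
have bxD s t : bx s = bx t -> `|fr s - fr t| < e.
  move=> /(congr1 val) /=; rewrite !bxE => st.
  have hs : 0 <= K%:R * fr s by rewrite mulr_ge0// ltW.
  have ht : 0 <= K%:R * fr t by rewrite mulr_ge0// ltW.
  have /andP[s1 s2] := truncn_itv hs.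
  have /andP[t1 t2] := truncn_itv ht.
  apply: lt_trans Ke; rewrite -(ltr_pM2l K0) mulfV ?gt_eqF//.
  rewrite -[X in X * _]gtr0_norm// -normrM mulrBr.
  rewrite -st in t1 t2; move: s1 s2 t1 t2; rewrite -natr1 => *.
  by rewrite ltr_norml; apply/andP; split; lra.
pose f (j : 'I_(K * K).+1) := (bx (j%:R * al), bx (j%:R * be)).
have /injectivePn[i [j ij fij]] : ~~ injectiveb f.
  apply/negP => /injectiveP /leq_card.
  by rewrite card_prod !card_ord ltnn.
suff H (i' j' : 'I_(K * K).+1) : f i' = f j' -> (i' < j')%N ->
    exists (q : nat) (a b : int),
    [/\ (0 < q)%N, `|q%:R * al - a%:~R| < e & `|q%:R * be - b%:~R| < e].
  have [lt|lt|/val_inj E] := ltngtP i j; [exact: H lt|exact: H (esym fij) lt|].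
  by rewrite E eqxx in ij.
move=> [h1 h2] lt; exists (j' - i')%N.
exists (Num.floor (j'%:R * al) - Num.floor (i'%:R * al)).
exists (Num.floor (j'%:R * be) - Num.floor (i'%:R * be)).
split; first by rewrite subn_gt0.
- have := bxD _ _ (esym h1); rewrite /fr natrB ?(ltnW lt)// rmorphB/=.
  by congr (`| _ | < _); ring.
- have := bxD _ _ (esym h2); rewrite /fr natrB ?(ltnW lt)// rmorphB/=.
  by congr (`| _ | < _); ring.
Qed.

(** Rounding a real multiple of a short vector down to an integer multiple moves
    it by at most the length of that vector. *)
Lemma floor_step (R : realType) (v l : R) :
  `|(Num.floor l)%:~R * v - l * v| <= `|v|.
Proof.
rewrite -mulrBl normrM ler_piMl// ler_norml.
have /andP[] := floor_itv l; rewrite rmorphD/= => *; apply/andP; split; lra.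
Qed.

(** A nonzero multiple [v] of [al] modulo the integers with [`|v| < e], as
    provided by [dirichlet2], has integer multiples [e]-close to every real. *)
Lemma kronecker1 (R : realType) (al s e : R) : irrational al -> 0 < e ->
  exists j a : int, `|j%:~R * al - a%:~R - s| < e.
Proof.
move=> irr e0; have [q [a [_ [q0 va _]]]] := dirichlet2 al al e0.
set v := _ - _ in va.
have v0 : v != 0.
  rewrite /v; have := @irrational_neq_int_frac _ al q (- a) irr.
  by rewrite rmorphN/=; apply; rewrite -lt0n in q0 *; lia.
exists (Num.floor (s / v) * q), (Num.floor (s / v) * a).
rewrite !rmorphM/= -mulrA -mulrBr.
have := floor_step v (s / v); rewrite divfK// => /le_lt_trans; exact.
Qed.

(** It suffices to find in the group generated by [(al, be)] and the integer
    vectors two vectors [v], [w] shorter than [e / 2] that are not collinear: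
    rounding the coordinates of [(s, t)] in the basis [v, w] then answers the
    question.  Take [v] short with the least possible multiplier [q], and [w]
    with multiplier [q'], shorter than both coordinates of [v].  If [v] and [w]
    were collinear, independence would force the integer vectors that define
    them to be proportional, so [w = (q' / q) v]; as [w] is shorter than [v],
    [q' < q], against the choice of [q]. *)
Lemma kronecker2 (R : realType) (al be : R) :
  (forall a b c : int, a%:~R * al + b%:~R * be + c%:~R = 0 -> a = 0 /\ b = 0) ->
  forall s t e : R, 0 < e -> exists j a b : int,
    `|j%:~R * al - a%:~R - s| < e /\ `|j%:~R * be - b%:~R - t| < e.
Proof.
move=> ind s t e e0.
pose P (d : R) (q : nat) := (0 < q)%N /\ exists a b : int,
  `|q%:R * al - a%:~R| < d /\ `|q%:R * be - b%:~R| < d.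
have exP d : 0 < d -> exists q, P d q.
  by move=> /(dirichlet2 al be)[q [a [b [? ? ?]]]]; exists q; split => //; exists a, b.
have e20 : 0 < e / 2 by lra.
have : exists q, `[< P (e / 2) q >].
  by have [q Pq] := exP _ e20; exists q; apply/asboolP.
move=> /ex_minnP[q /asboolP[q0 [a [b [va vb]]]] qmin].
set v1 := _ - _ in va; set v2 := _ - _ in vb.
have v10 : v1 != 0.
  apply/eqP => h; have [] := ind q 0 (- a); last by lia.
  by rewrite -[RHS]h /v1 rmorphN/=; ring.
have v20 : v2 != 0.
  apply/eqP => h; have [] := ind 0 q (- b); last by lia.
  by rewrite -[RHS]h /v2 rmorphN/=; ring.
have d0 : 0 < Num.min `|v1| `|v2| by rewrite lt_min !normr_gt0 v10.
have [q' [q'0 [a' [b' []]]]] := exP _ d0.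
set w1 := _ - _; set w2 := _ - _; rewrite !lt_min => /andP[w11 w12] /andP[w21 w22].
(* The vanishing of the determinant is an integer relation between
   [al], [be] and [1]; its coefficients are two-by-two minors. *)
have det0 : v1 * w2 - v2 * w1 != 0.
  apply/eqP => D.
  have [h1 h2] : b * q'%:Z - q%:Z * b' = 0 /\ q%:Z * a' - a * q'%:Z = 0.
    apply: (ind _ _ (a * b' - b * a')); rewrite -[RHS]D /v1 /v2 /w1 /w2.
    by rewrite !(rmorphB, rmorphM)/=; ring.
  have E : q%:R * w1 = q'%:R * v1.
    have := congr1 (fun z : int => z%:~R : R) h2.
    rewrite rmorphB !rmorphM/= /w1 /v1 => h.
    by lra.
  have lt : (q' < q)%N.
    rewrite -(ltr_nat R) -(ltr_pM2r (_ : 0 < `|v1|)) ?normr_gt0//.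
    rewrite -[X in X * _ < _]normr_nat -normrM -E normrM normr_nat.
    by rewrite ltr_pM2l// ltr0n.
  move: (qmin q'); rewrite leqNgt lt; case/(_ _)/Bool.diff_false_true.
  apply/asboolP; split => //; exists a', b'; split.
    exact: lt_trans w11 va.
  exact: lt_trans w22 vb.
pose l := (s * w2 - t * w1) / (v1 * w2 - v2 * w1).
pose m := (t * v1 - s * v2) / (v1 * w2 - v2 * w1).
have sE : s = l * v1 + m * w1 by rewrite /l /m; field.
have tE : t = l * v2 + m * w2 by rewrite /l /m; field.
pose L := Num.floor l; pose M := Num.floor m.
exists (L * q + M * q'), (L * a + M * a'), (L * b + M * b').
have close x y : `|x| < e / 2 -> `|y| < `|x| ->
    `|L%:~R * x + M%:~R * y - (l * x + m * y)| < e.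
  move=> xe yx.
  have -> : L%:~R * x + M%:~R * y - (l * x + m * y) =
    (L%:~R * x - l * x) + (M%:~R * y - m * y) by ring.
  apply: le_lt_trans (ler_normD _ _) _.
  have := floor_step x l; have := floor_step y m; rewrite -/L -/M => *.
  by lra.
split.
  have := close v1 w1 va w11; rewrite -sE; congr (`| _ | < _).
  by rewrite !(rmorphD, rmorphM)/= /v1 /w1; ring.
have := close v2 w2 vb w22; rewrite -tE; congr (`| _ | < _).
by rewrite !(rmorphD, rmorphM)/= /v2 /w2; ring.
Qed.

(** * The circle as a topological group *)

Lemma to_circle_nmod_morphism (R : realType) : nmod_morphism (@to_circle R).
Proof. split; last exact: to_circleD.
by apply: (addrI (to_circle 0)); rewrite -to_circleD !addr0. Qed.

HB.instance Definition _ (R : realType) :=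
  GRing.isNmodMorphism.Build R (circle R) (@to_circle R)
    (@to_circle_nmod_morphism R).

Section Circle.
Context {R : realType}.

Lemma to_circle_surj (y : circle R) : exists t : R, to_circle t = y.
Proof. by exists (repr y); exact: reprK. Qed.

Lemma to_circle_eq0 (t : R) : to_circle t = 0 <-> t \is a Num.int.
Proof. by rewrite -[0](raddf0 (@to_circle R)) to_circle_eq subr0. Qed.

Lemma to_circle_continuous : continuous (@to_circle R).
Proof. exact: pi_continuous. Qed.

(** The projection is open: the preimage of the image of an open set is the
    union of its integer translates. *)
Lemma to_circle_nbhs (t : R) (A : set R) :
  nbhs t A -> nbhs (to_circle t) (@to_circle R @` A).
Proof.
move=> tA.
apply: (@filterS _ _ _ (@to_circle R @` A°)).
  by apply: image_subset; exact: interior_subset.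
apply: open_nbhs_nbhs; split; last first.
  by exists t.
rewrite /open/= /quotient_open.
rewrite (_ : _ @^-1` _ =
    \bigcup_(k : int) ((fun z : R => z + k%:~R) @^-1` A°)); last first.
  apply/seteqP; split => [z [y Ay /to_circle_eq/intrP[k yz]]|z [k _ Ak]].
    by exists k => //=; rewrite -yz addrC subrK.
  exists (z + k%:~R) => //; apply/to_circle_eq.
  by rewrite addrC addKr; apply/intrP; exists k.
apply: bigcup_open => k _; apply: open_comp; last exact: open_interior.
by move=> z _; apply: cvgD; [exact: cvg_id|exact: cvg_cst].
Qed.

Lemma circle_sub_continuous :
  continuous (fun y : circle R * circle R => y.1 - y.2).
Proof.
move=> [y z]; have [s <-] := to_circle_surj y; have [t <-] := to_circle_surj z.
move=> A /=; rewrite -raddfB => /to_circle_continuous A'.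
have [[B C] /= [sB tC] BC] : nbhs (s, t) (fun p : R * R => A (to_circle (p.1 - p.2))).
  exact: (@sub_continuous R (s, t) _ A').
exists (@to_circle R @` B, @to_circle R @` C).
  by split; exact: to_circle_nbhs.
by move=> [_ _] [/= [b Bb <-] [c Cc <-]]; rewrite -raddfB; exact: (BC (b, c)).
Qed.

HB.instance Definition _ :=
  PreTopologicalNmodule_isTopologicalZmodule.Build (circle R)
    circle_sub_continuous.

(** The lifts of the complement of a point form the union of the intervals
    between consecutive lifts of that point. *)
Lemma circle_closed1 (y : circle R) : closed [set y].
Proof.
have [t <-] := to_circle_surj y.
rewrite -openC /open/= /quotient_open.
rewrite (_ : _ @^-1` _ =
    \bigcup_(k : int) `]t + k%:~R, t + k%:~R + 1[%classic).
  by apply: bigcup_open => k _; exact: interval_open.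
apply/seteqP; split => z /=; last first.
  move=> [k _] /=; rewrite in_itv/= => /andP[h1 h2].
  move=> /to_circle_eq/intrP[m zE].
  have /[!ltr_int] km : k%:~R < m%:~R :> R by lra.
  have /[!ltr_int] mk : m%:~R < (k + 1)%:~R :> R by rewrite rmorphD/=; lra.
  lia.
move=> zt; exists (Num.floor (z - t)) => //=; rewrite in_itv/=.
have /andP[h1 h2] := floor_itv (z - t); rewrite rmorphD/= in h2.
rewrite lt_neqAle; apply/andP; split; last by lra.
apply/andP; split; last by lra.
apply: contra_not_neq zt => zE; apply/to_circle_eq/intrP.
by exists (Num.floor (z - t)); rewrite -{1}zE addrC addKr.
Qed.
End Circle.

Section TopologicalZmod.
Context {T : topologicalType} {G : topologicalZmodType}.

Lemma continuousD_zmod (f g : T -> G) :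
  continuous f -> continuous g -> continuous (fun y => f y + g y).
Proof.
move=> cf cg y; apply: (@continuous_comp _ _ _ (fun y => (f y, g y))
  (fun x : G * G => x.1 + x.2)); last exact: add_continuous.
by apply: cvg_pair; [exact: cf|exact: cg].
Qed.

Lemma continuousB_zmod (f g : T -> G) :
  continuous f -> continuous g -> continuous (fun y => f y - g y).
Proof.
move=> cf cg; apply: continuousD_zmod => // y.
by apply: continuous_comp; [exact: cg|exact: opp_continuous].
Qed.

Lemma continuousMz_zmod (f : T -> G) (k : int) :
  continuous f -> continuous (fun y => f y *~ k).
Proof.
move=> cf.
have H m : continuous (fun y => f y *+ m).
  elim: m => [|m IH].
    rewrite (_ : (fun _ => _) = cst 0); first exact: cst_continuous.
    by apply/funext => y; rewrite mulr0n.
  rewrite (_ : (fun _ => _) = fun y => f y + f y *+ m).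
    exact: continuousD_zmod.
  by apply/funext => y; rewrite mulrS.
case: k => m; first exact: H.
rewrite (_ : (fun _ => _) = fun y => - (f y *+ m.+1)).
  by move=> y; apply: (@continuous_comp _ _ _ (fun y => f y *+ m.+1) -%R);
    [exact: H|exact: opp_continuous].
by apply/funext => y; rewrite NegzE mulrNz.
Qed.

Lemma continuous_sum_zmod (I : Type) (r : seq I) (f : I -> T -> G) :
  (forall i, continuous (f i)) -> continuous (fun y => \sum_(i <- r) f i y).
Proof.
move=> cf; elim: r => [|i r IH].
  rewrite (_ : (fun _ => _) = cst 0); first exact: cst_continuous.
  by apply/funext => y; rewrite big_nil.
rewrite (_ : (fun _ => _) = fun y => f i y + \sum_(j <- r) f j y).
  exact: continuousD_zmod.
by apply/funext => y; rewrite big_cons.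
Qed.
End TopologicalZmod.

(** * Integer relations between the frequencies *)

(** [g] is the least positive integer combination of the [P i]: the remainder of
    [P i] modulo [g] is again such a combination, so it vanishes. *)
Lemma bezout_family (I : finType) (P : I -> int) (i0 : I) : P i0 != 0 ->
  exists (g : int) (p u : I -> int),
    [/\ g != 0, forall i, P i = g * p i & \sum_i u i * p i = 1].
Proof.
move=> P0.
pose Q (m : nat) := (0 < m)%N /\ exists u : I -> int, \sum_i u i * P i = m.
have : exists m, `[< Q m >].
  exists `|P i0|%N; apply/asboolP; split; first by rewrite absz_gt0.
  exists (fun i => if i == i0 then sgz (P i) else 0).
  rewrite (bigD1 i0)//= eqxx big1 ?addr0 => [|i /negPf->]; last by rewrite mul0r.
  by rewrite abszEsg.
move=> /ex_minnP[g /asboolP[g0 [u ug]] gmin].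
have g0' : g%:Z != 0 by lia.
have dvd i : P i = g%:Z * (P i %/ g)%Z.
  rewrite mulrC; apply/eqP; rewrite eq_sym -dvdz_eq; apply/dvdz_mod0P.
  have r0 : 0 <= (P i %% g)%Z by exact: modz_ge0.
  have rg : (P i %% g)%Z < g by apply: ltz_pmod; lia.
  apply/eqP; apply: contraT => rn0.
  have : `[< Q `|(P i %% g)%Z|%N >].
    apply/asboolP; split; first by rewrite absz_gt0.
    exists (fun j => (j == i)%:R - (P i %/ g)%Z * u j).
    rewrite gez0_abs//.
    under eq_bigr do rewrite mulrBl -mulrA.
    rewrite sumrB -mulr_sumr ug (bigD1 i)//= eqxx mul1r big1 ?addr0 => [|j /negPf->].
      by rewrite {1}(divz_eq (P i) g) addrC addKr.
    by rewrite mul0r.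
  by move=> /gmin; lia.
exists g%:Z, (fun i => (P i %/ g)%Z), u; split=> //.
apply: (mulfI g0'); rewrite mulr1 -[RHS]ug mulr_sumr.
by apply: eq_bigr => i _; rewrite mulrCA -dvd.
Qed.

(** Let [theta] be the combination [\sum_i u i * alpha i].  With a common
    denominator [A], the relations read
    [A * alpha i = g * p i * alpha i0 + integer] with [\sum_i u i * p i = 1];
    summing them gives [A * theta = g * alpha i0 + integer], which makes [theta]
    irrational and [A * (alpha i - p i * theta)] an integer. *)
Lemma rational_direction (R : realType) (n : nat) (alpha : 'I_n -> R) (i0 : 'I_n) :
  irrational (alpha i0) ->
  (forall i, exists a b c : int,
     a != 0 /\ a%:~R * alpha i = b%:~R * alpha i0 + c%:~R) ->
  exists (p u : 'I_n -> int) (N : nat),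
    [/\ (0 < N)%N, \sum_i u i * p i = 1,
        irrational (\sum_i (u i)%:~R * alpha i) &
        forall i, N%:R * (alpha i - (p i)%:~R * \sum_i (u i)%:~R * alpha i)
          \is a Num.int].
Proof.
move=> irr /choice[a /choice[b /choice[c abc]]].
pose A := \prod_i a i.
have A0 : A != 0 by apply/prodf_neq0 => i _; have [] := abc i.
pose A' i := \prod_(j | j != i) a j.
have AE i : A = a i * A' i by rewrite /A (bigD1 i).
have rel i : A%:~R * alpha i = (b i * A' i)%:~R * alpha i0 + (c i * A' i)%:~R.
  have [_ h] := abc i.
  by rewrite (AE i) rmorphM mulrAC h !rmorphM mulrDl; ring.
have P0 : b i0 * A' i0 != 0.
  apply/eqP => h.
  have /eqP := @irrational_neq_int_frac _ _ A (- (c i0 * A' i0)) irr A0; apply.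
  by rewrite (rel i0) h rmorphN/= mul0r add0r subrr.
have [g [p [u [g0 Pgp up]]]] := @bezout_family _ (fun i => b i * A' i) i0 P0.
pose C := \sum_i u i * (c i * A' i).
have thE : A%:~R * (\sum_i (u i)%:~R * alpha i) = g%:~R * alpha i0 + C%:~R.
  transitivity (\sum_i (u i)%:~R *
     ((g * p i)%:~R * alpha i0 + (c i * A' i)%:~R)).
    by rewrite mulr_sumr; apply: eq_bigr => i _; rewrite mulrCA rel Pgp.
  rewrite /C rmorph_sum/=; under eq_bigr do rewrite mulrDr.
  rewrite big_split/=; congr +%R; last by under [RHS]eq_bigr do rewrite rmorphM.
  rewrite -[in RHS](mulr1 g) -up mulr_sumr rmorph_sum mulr_suml.
  by apply: eq_bigr => i _; rewrite !rmorphM/=; ring.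
exists p, u, `|A|%N; split=> //; first by rewrite absz_gt0.
- move=> [q _ qE].
  have := @irrational_neq_int_frac _ _ (g * denq q) (C * denq q - A * numq q) irr.
  case/(_ _)/eqP; first by rewrite mulf_neq0// denq_neq0.
  move: thE; rewrite -qE -{1}(divq_num_den q) fmorph_div/= !ratr_int.
  have d0 : (denq q)%:~R != 0 :> R by rewrite intr_eq0 denq_neq0.
  rewrite !(rmorphB, rmorphM)/= => h.
  have -> : g%:~R * (denq q)%:~R * alpha i0 = (g%:~R * alpha i0 + C%:~R) * (denq q)%:~R - C%:~R * (denq q)%:~R by ring.
  by rewrite -h; field.
- move=> i.
  have int : A%:~R * (alpha i - (p i)%:~R * \sum_i (u i)%:~R * alpha i) \is a Num.int.
    rewrite mulrBr rel mulrCA thE Pgp; apply/intrP.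
    exists (c i * A' i - p i * C).
    by rewrite !(rmorphB, rmorphM)/=; ring.
  rewrite -[`|A|%N%:R]/((`|A|%N%:Z)%:~R) abszEsg rmorphM/= -mulrA rpredM//.
  exact: intr_int.
Qed.

(** Otherwise [kronecker2] gives a time [k] at which both rotations are within
    half an arc length of the centres of their arcs, so that the letter at
    position [k] would be both [i] and [j].  The relation can be taken with a
    nonzero coefficient at [alpha i] because [alpha j] is irrational. *)
Lemma letters_dependent (R : realType) (n : nat) (W : int -> 'I_n)
    (alpha : 'I_n -> R) (Delta : 'I_n -> set (circle R)) (x : torus R n) :
  (forall i, generated_by (letter_word W i) (alpha i) (Delta i) (x i)) ->
  forall i j, exists a b c : int,
    a != 0 /\ a%:~R * alpha i = b%:~R * alpha j + c%:~R.
Proof.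
move=> gen i j.
have [->|ij] := eqVneq i j.
  by exists 1, 1, 0; split=> //; rewrite addr0.
apply: contrapT => nodep.
have [irri [/andP[li0 _] [ci [bli [bri Di]]]] geni] := gen i.
have [irrj [/andP[lj0 _] [cj [blj [brj Dj]]]] genj] := gen j.
have ind (a b c : int) :
    a%:~R * alpha i + b%:~R * alpha j + c%:~R = 0 -> a = 0 /\ b = 0.
  move=> h.
  have a0 : a = 0.
    apply/eqP; apply: contra_notT nodep => a0.
    by exists a, (- b), (- c); split=> //; rewrite !rmorphN/=; lra.
  split=> //; apply/eqP; apply: contraT => b0.
  have := irrational_neq_int_frac c irrj b0.
  by move: h; rewrite a0 mul0r add0r => ->; rewrite eqxx.
have [si xi] := to_circle_surj (x i); have [sj xj] := to_circle_surj (x j).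
have e0 : 0 < Num.min (alpha i / 2) (alpha j / 2).
  by rewrite lt_min !divr_gt0.
have [k [a [b []]]] := kronecker2 ind (ci + alpha i / 2 - si)
   (cj + alpha j / 2 - sj) e0.
rewrite !lt_min => /andP[hi _] /andP[_ hj].
(* Membership in the arc only uses its interior, so that the same argument
   covers open, half-open and closed arcs. *)
have hit l c s bl br (D : set (circle R)) m :
    D = @to_circle R @` [set` Interval (BSide bl c) (BSide br (c + l))] ->
    `|k%:~R * l - m%:~R - (c + l / 2 - s)| < l / 2 ->
    D (translation_pow (to_circle l) k (to_circle s)).
  move=> -> ; rewrite ltr_norml => /andP[h1 h2].
  exists (s + k%:~R * l - m%:~R).
    rewrite /= in_itv; case: bl; case: br => /=; apply/andP; split; lra.
  rewrite translation_powE -raddfMz/= -raddfD; apply/to_circle_eq.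
  rewrite -mulrzl (_ : _ - _ = - m%:~R); last by ring.
  by rewrite rpredN; exact: intr_int.
have Wi : letter_word W i k by apply/geni; rewrite -xi; exact: hit Di hi.
have Wj : letter_word W j k by apply/genj; rewrite -xj; exact: hit Dj hj.
by move: ij; rewrite -(eqP Wi) -(eqP Wj) eqxx.
Qed.

(** * Closures of orbits in a group containing a circle as a direct factor *)

Lemma torsion_order (G : zmodType) (e : G) (N0 : nat) :
  (0 < N0)%N -> e *+ N0 = 0 ->
  exists N : nat, [/\ (0 < N)%N, e *+ N = 0 &
    forall k l : nat, (k < N)%N -> (l < N)%N -> e *+ k = e *+ l -> k = l].
Proof.
move=> N00 eN0.
have : exists N, (0 < N)%N && (e *+ N == 0).
  by exists N0; rewrite N00 eN0 eqxx.
move=> /ex_minnP[N /andP[Npos /eqP eN] Nmin]; exists N; split=> //.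
have H k l : (k <= l)%N -> (l < N)%N -> e *+ k = e *+ l -> k = l.
  move=> kl lN ekl; apply/eqP; rewrite eqn_leq kl/= -subn_eq0.
  rewrite -leqn0 leqNgt; apply/negP => lk.
  have := Nmin (l - k)%N; rewrite lk mulrnBr// ekl subrr eqxx => /(_ isT).
  by rewrite leqNgt (leq_ltn_trans (leq_subr _ _) lN).
move=> k l kN lN ekl; have [kl|/ltnW lk] := leqP k l; first exact: H.
by apply/esym/H.
Qed.

Lemma mulrz_mod_order (G : zmodType) (e : G) (N : nat) : (0 < N)%N ->
  e *+ N = 0 -> forall j : int, exists k : 'I_N, e *~ j = e *+ k.
Proof.
move=> N0 eN j.
have kN : (`|(j %% N)%Z| < N)%N.
  have := @modz_ge0 j N; have := @ltz_pmod j N; lia.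
exists (Ordinal kN); rewrite /= pmulrn gez0_abs; last by apply: modz_ge0; lia.
rewrite {1}(divz_eq j N) mulrzDr mulrC mulrzA -pmulrn eN.
by rewrite mul0rz add0r.
Qed.

Lemma dense_rotation (R : realType) (al : R) (s : R) (A : set (circle R)) :
  irrational al -> nbhs (to_circle s) A -> exists j : int, A (to_circle al *~ j).
Proof.
move=> irr /to_circle_continuous/nbhs_ballP[e /= e0 eA].
have [j [a jas]] := kronecker1 s irr e0; exists j.
have -> : to_circle al *~ j = to_circle (j%:~R * al - a%:~R).
  rewrite -raddfMz; apply/to_circle_eq; rewrite -mulrzl.
  by rewrite opprB addrC subrK; exact: intr_int.
by apply: eA; rewrite /ball/= distrC.
Qed.

(** Near [y], [h] avoids the finitely many values [F l] with [l != k y], because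
    they form a closed set. *)
Lemma discrete_index_continuous (T G : topologicalType) (N : nat)
    (F : 'I_N -> G) (h : T -> G) (k : T -> discrete_topology 'I_N) :
  (forall z : G, closed [set z]) -> injective F -> continuous h ->
  (forall y, h y = F (k y)) -> continuous k.
Proof.
move=> cl1 injF ch hF y A /principal_filterP Ay.
have clB : closed (\bigcup_(l in [set l | l != k y]) [set F l]).
  by apply: closed_bigcup => [|l _]; first exact: finite_finset.
have : nbhs y (h @^-1` ~` (\bigcup_(l in [set l | l != k y]) [set F l])).
  apply: ch; apply: open_nbhs_nbhs; split; first exact: closed_openC.
  by move=> [l /= /eqP lk]; rewrite hF => /injF /esym.
apply: filterS => z /= hz; suff -> : k z = k y by [].
by apply: contrapT => /eqP kz; apply: hz; exists (k z) => //=; rewrite hF.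
Qed.

Lemma continuous_pair (T U V : topologicalType) (f : T -> U) (g : T -> V) :
  continuous f -> continuous g -> continuous (fun y => (f y, g y)).
Proof. by move=> cf cg y; apply: cvg_pair; [exact: cf|exact: cg]. Qed.

Lemma continuous_prod_discrete (T G : topologicalType) (X : choiceType)
    (f : T * discrete_topology X -> G) :
  (forall k, continuous (fun t => f (t, k))) -> continuous f.
Proof.
move=> cf [t k] A fA.
exists ([set t' | A (f (t', k))], [set k]); first split=> /=.
- exact: cf.
- exact: discrete_set1.
- by move=> [t' k'] /= [At' ->].
Qed.

Section OrbitClosure.
Context {R : realType} {G : topologicalZmodType}.
Variables (iota : {additive circle R -> G}) (L : {additive G -> circle R}).
Hypotheses (iota_cont : continuous iota) (L_cont : continuous L).
Hypothesis (iotaK : cancel iota L).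
Variables (theta : R) (e : G) (N : nat).
Hypotheses (Npos : (0 < N)%N) (eN : e *+ N = 0) (Le : L e = 0).
Hypothesis closed1 : forall z : G, closed [set z].
Hypothesis theta_irr : irrational theta.

Let gamma := iota (to_circle theta) + e.

(** The projection onto the kernel of [L] along the image of [iota]. *)
Definition residue (z : G) : G := z - iota (L z).

Lemma residue_continuous : continuous residue.
Proof.
apply: (@continuousB_zmod G G id); first by move=> ?; exact: cvg_id.
by move=> z; apply: continuous_comp; [exact: L_cont|exact: iota_cont].
Qed.

Lemma residueE (t : circle R) (k : nat) : residue (iota t + e *+ k) = e *+ k.
Proof.
by rewrite /residue raddfD/= iotaK raddfMn/= Le mul0rn addr0 addrC addKr.
Qed.

(** The right-hand side is closed, being a finite union of preimages of points,
    and contains the trajectory since the [j]-th point [y] of it has residue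
    [residue (y - x) = e *~ j].  Conversely, with [k] fixed, the times
    [j = k + N * m] all give residue [e *+ k], while the circle coordinates
    [j * theta] are dense since [N * theta] is irrational. *)
Lemma orbit_closureE (x : G) :
  closure (trajectory gamma x) =
  [set y | exists k : 'I_N, residue (y - x) = e *+ k].
Proof.
apply/seteqP; split.
  rewrite closureE; apply: smallest_sub.
    rewrite (_ : [set y | _] =
        \bigcup_(k in [set: 'I_N]) ((fun y => residue (y - x)) @^-1` [set e *+ k])).
      apply: closed_bigcup => [|k _]; first exact: finite_finset.
      apply: (@continuous_closedP _ _ (fun y => residue (y - x))).1; last exact: closed1.
      move=> y; apply: (@continuous_comp _ _ _ (fun y => y - x) residue).
        apply: (@continuousB_zmod G G id (cst x)); last exact: cst_continuous.
        by move=> ?; exact: cvg_id.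
      exact: residue_continuous.
    by apply/seteqP; split => [y [k yk]|y [k _ yk]]; exists k.
  move=> _ [j _ <-]; have [k ek] := mulrz_mod_order Npos eN j.
  exists k; rewrite translation_powE addrC addKr /gamma mulrzDl ek -raddfMz.
  exact: residueE.
move=> y [k yk] A yA.
have [s sE] := to_circle_surj (L (y - x)).
pose f (t : circle R) := x + (iota t + e *+ k).
have fs : f (to_circle s) = y.
  by rewrite /f sE -yk /residue [iota _ + _]addrC subrK addrC subrK.
have fcont : continuous f.
  apply: continuousD_zmod; first exact: cst_continuous.
  by apply: continuousD_zmod => //; exact: cst_continuous.
pose t1 : circle R := to_circle theta *+ k.
have irrN : irrational (theta *+ N).
  move=> [q _ qE]; apply: theta_irr; exists (q / N%:R) => //.
  rewrite fmorph_div/= ratr_nat qE -(mulr_natr theta) mulfK// pnatr_eq0.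
  by rewrite -lt0n.
pose B := (fun t => f (t1 + t)) @^-1` A.
have BA : nbhs (to_circle (s - theta *+ k)) B.
  apply: (@continuousD_zmod _ _ (cst t1) id _ _ (to_circle (s - theta *+ k))
    (f @^-1` A)); [exact: cst_continuous|by move=> ?; exact: cvg_id|].
  rewrite /t1 -raddfMn -raddfD addrC subrK.
  by apply: fcont; rewrite fs.
have [m Bm] := dense_rotation irrN BA.
exists (f (t1 + to_circle (theta *+ N) *~ m)); split; last exact: Bm.
exists (k%:Z + N%:Z * m) => //.
rewrite translation_powE /f /gamma mulrzDl !mulrzDr !mulrzA -!pmulrn eN mul0rz addr0.
by rewrite raddfD /t1 !raddfMz !raddfMn.
Qed.

Lemma orbit_closure_homeomorphic (x : G) :
  (forall k l : nat, (k < N)%N -> (l < N)%N -> e *+ k = e *+ l -> k = l) ->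
  homeomorphic (set_type (closure (trajectory gamma x)))
    (circle R * discrete_topology 'I_N)%type.
Proof.
move=> order; rewrite orbit_closureE.
set M := [set y | _].
have /choice[k kE] (y : set_type M) :
    exists k : 'I_N, residue (\val y - x) = e *+ k.
  by have := set_valP y.
have Mg (p : circle R * discrete_topology 'I_N) :
    (x + (iota p.1 + e *+ (p.2 : 'I_N))) \in M.
  by rewrite inE; exists p.2; rewrite addrC addKr residueE.
pose f (y : set_type M) : (circle R * discrete_topology 'I_N)%type :=
  (L (\val y - x), k y).
pose g (p : circle R * discrete_topology 'I_N) : set_type M :=
  @exist G (fun z => z \in M) _ (Mg p).
have val_cont : continuous (fun y : set_type M => \val y - x).
  apply: (@continuousB_zmod _ _ set_val (cst x)); last exact: cst_continuous.
  exact: (@initial_continuous M G set_val).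
have injF : injective (fun l : 'I_N => e *+ l).
  by move=> l m lm; apply: val_inj; exact: order lm.
exists f, g; split.
- apply: (@continuous_pair _ _ (discrete_topology 'I_N)).
    move=> y.
    apply: (@continuous_comp _ _ _ (fun y : set_type M => \val y - x) L).
      exact: val_cont.
    exact: L_cont.
  apply: (discrete_index_continuous closed1 injF _ kE).
  move=> z; apply: (@continuous_comp _ _ _ (fun y : set_type M => \val y - x) residue).
    exact: val_cont.
  exact: residue_continuous.
- apply: continuous_comp_initial; apply: continuous_prod_discrete => l.
  apply: continuousD_zmod; first exact: cst_continuous.
  by apply: continuousD_zmod => //; exact: cst_continuous.
- move=> y; apply/val_inj => /=.
  by rewrite -kE /residue [iota _ + _]addrC subrK addrC subrK.
- move=> [t l]; congr pair => /=.
    by rewrite addrC addKr raddfD/= iotaK raddfMn/= Le mul0rn addr0.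
  by apply: injF; rewrite -kE /= addrC addKr residueE.
Qed.
End OrbitClosure.

(** * The torus as a topological group *)

Section Torus.
Context {R : realType} {n : nat}.

Lemma torus_continuous (T : topologicalType) (f : T -> torus R n) :
  (forall i, continuous (fun y => f y i)) -> continuous f.
Proof.
move=> cf y; apply/cvg_sup => i; move: y.
apply/(@continuousP _ (initial_topology (fun z : torus R n => z i))).
move=> _ [B oB <-].
by apply: (@open_comp _ _ (fun y => f y i)) => // y _; exact: cf.
Qed.

Lemma torus_coord_continuous (i : 'I_n) :
  continuous (fun y : torus R n => y i).
Proof. exact: (@proj_continuous 'I_n (fun=> circle R) i). Qed.

Lemma torus_sub_continuous :
  continuous (fun y : torus R n * torus R n => y.1 - y.2).
Proof.
apply: torus_continuous => i.
apply: (@continuousB_zmod _ _ (fun y : torus R n * torus R n => y.1 i)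
   (fun y : torus R n * torus R n => y.2 i)) => y.
  apply: (@continuous_comp _ _ _ fst (fun y : torus R n => y i)).
    exact: cvg_fst.
  exact: torus_coord_continuous.
apply: (@continuous_comp _ _ _ snd (fun y : torus R n => y i)).
  exact: cvg_snd.
exact: torus_coord_continuous.
Qed.

Lemma torus_closed1 (y : torus R n) : closed [set y].
Proof.
rewrite (_ : [set y] =
    \bigcap_(i in [set: 'I_n]) ((fun z : torus R n => z i) @^-1` [set y i])).
  apply: closed_bigI => i _.
  apply: (@continuous_closedP _ _ (fun z : torus R n => z i)).1.
    exact: torus_coord_continuous.
  exact: circle_closed1.
apply/seteqP; split => [_ -> i _ //|z /= zy].
by apply/funext => i; exact: zy.
Qed.
End Torus.

HB.instance Definition _ (R : realType) (n : nat) :=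
  PreTopologicalNmodule_isTopologicalZmodule.Build (torus R n)
    torus_sub_continuous.

Section Characters.
Context {R : realType} {n : nat}.

Definition one_parameter (p : 'I_n -> int) (t : circle R) : torus R n :=
  fun i => t *~ p i.

Lemma one_parameter_zmod_morphism p : zmod_morphism (one_parameter p).
Proof. by move=> s t; apply/funext => i; rewrite /one_parameter mulrzBl. Qed.

HB.instance Definition _ p :=
  GRing.isZmodMorphism.Build (circle R) (torus R n) (one_parameter p)
    (one_parameter_zmod_morphism p).

Lemma one_parameter_continuous p : continuous (one_parameter p).
Proof.
apply: torus_continuous => i; apply: (@continuousMz_zmod _ _ id).
by move=> t; exact: cvg_id.
Qed.

Definition torus_character (u : 'I_n -> int) (y : torus R n) : circle R :=
  \sum_i y i *~ u i.

Lemma torus_character_zmod_morphism u : zmod_morphism (torus_character u).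
Proof.
move=> y z; rewrite /torus_character -sumrB.
by apply: eq_bigr => i _; rewrite -mulrzBl.
Qed.

HB.instance Definition _ u :=
  GRing.isZmodMorphism.Build (torus R n) (circle R) (torus_character u)
    (torus_character_zmod_morphism u).

Lemma torus_character_continuous u : continuous (torus_character u).
Proof.
apply: continuous_sum_zmod => i.
by apply: continuousMz_zmod; exact: torus_coord_continuous.
Qed.

Lemma one_parameterK (p u : 'I_n -> int) : \sum_i u i * p i = 1 ->
  cancel (one_parameter p) (torus_character u).
Proof.
move=> up t; rewrite /torus_character /one_parameter.
under eq_bigr do rewrite -mulrzA mulrC.
by rewrite -mulrz_sumr up.
Qed.
End Characters.

(** * The orbit closure of a balanced word *)

Theorem mainTheorem2 (R : realType) (n : nat) (W : int -> 'I_n)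
    (alpha : 'I_n -> R) (Delta : 'I_n -> set (circle R)) (x : torus R n)
    (gamma : torus R n) (M : set (torus R n)) :
  balanced_word W -> ~ periodic_word W ->
  (forall i, generated_by (letter_word W i) (alpha i) (Delta i) (x i)) ->
  gamma = (fun i => to_circle (alpha i)) ->
  M = closure (trajectory gamma x) ->
  exists N : nat,
    (0 < N)%N /\
    homeomorphic (set_type M) (circle R * discrete_topology 'I_N)%type.
Proof.
move=> _ _ gen gammaE ->.
have irr0 : irrational (alpha (W 0)) by have [] := gen (W 0).
have [p [u [N0 [N0pos up irr int]]]] :=
  rational_direction irr0 (fun i => letters_dependent gen i (W 0)).
set theta := \sum_i _ in irr int.
pose e : torus R n := fun i => to_circle (alpha i - (p i)%:~R * theta).
have gammaD : gamma = one_parameter p (to_circle theta) + e.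
  rewrite gammaE; apply/funext => i.
  rewrite /e addrfctE /one_parameter -raddfMz -raddfD -mulrzl.
  by congr to_circle; ring.
have eN0 : e *+ N0 = 0.
  apply/funext => i; rewrite natmulfctE /e -raddfMn -mulr_natl.
  exact/to_circle_eq0.
(* [theta] is by definition the image of [gamma] under the character. *)
have Le : torus_character u e = 0.
  have : torus_character u gamma = to_circle theta.
    rewrite gammaE /torus_character /theta raddf_sum.
    by apply: eq_bigr => i _; rewrite -raddfMz -mulrzl.
  rewrite gammaD raddfD/= one_parameterK// => /eqP.
  by rewrite -subr_eq0 addrC addKr => /eqP.
have [N [Npos eN order]] := torsion_order N0pos eN0.
exists N; split=> //; rewrite gammaD.
exact: (orbit_closure_homeomorphic (one_parameter_continuous (p := p))
  (torus_character_continuous (u := u)) (one_parameterK up) Npos eN Le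
  torus_closed1 irr).
Qed.
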